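(* Let $d=2^m$ with $m\ge1$ an integer, let $n\ge1$ and $k>2$ be integers, and let $R=\frac{1}{\sqrt d}HD$, where $H$ is the $d\times d$ Walsh–Hadamard matrix (with entries $\pm1$) and $D$ is a random diagonal matrix with i.i.d. Rademacher diagonal entries. For any $X_1,\dots,X_n\in\mathbb{R}^d$, the stochastic rotated quantization protocol $\pi_{srk}$ with rotation $R$ satisfies $$\mathcal{E}(\pi_{srk}(R),X^n)\;\le\;\frac{2\log d+2}{n(k-1)^2}\cdot\frac1n\sum_{i=1}^n\|X_i\|_2^2 ,$$ where $\log$ is the natural logarithm.
   Context: Walsh–Hadamard matrices: $H(2)=\begin{bmatrix}1&1\\1&-1\end{bmatrix}$, $H(2^m)=\begin{bmatrix}H(2^{m-1})&H(2^{m-1})\\H(2^{m-1})&-H(2^{m-1})\end{bmatrix}$; here $H=H(d)$. Rademacher: $\pm1$ with probability $1/2$ each. Client $i$ holds $X_i\in\mathbb{R}^d$; $X^n=(X_1,\dots,X_n)$, $\bar X=\frac1n\sum_iX_i$. Stochastic rotated quantization $\pi_{srk}(R)$: the random orthogonal matrix $R$ is generated with public randomness (known to all clients and the server). Client $i$ forms $Z_i=RX_i$, with $Z_i^{\max}=\max_jZ_i(j)$, $Z_i^{\min}=\min_jZ_i(j)$, $s_i=Z_i^{\max}-Z_i^{\min}$, and $B_i(r)=Z_i^{\min}+\frac{rs_i}{k-1}$ for integers $0\le r<k$. Given $R$, independently for all $i,j$: if $Z_i(j)\in[B_i(r),B_i(r+1))$ then $Y_i(j)=B_i(r+1)$ with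 probability $\frac{Z_i(j)-B_i(r)}{B_i(r+1)-B_i(r)}$ and $Y_i(j)=B_i(r)$ otherwise; if $Z_i(j)=B_i(k-1)$ then $Y_i(j)=Z_i(j)$ (in particular $Y_i=Z_i$ if $s_i=0$). The server outputs $\hat{\bar X}=R^{-1}\frac1n\sum_{i=1}^nY_i$. $\mathcal{E}(\pi_{srk}(R),X^n)=\mathbb{E}\|\hat{\bar X}-\bar X\|_2^2$, the expectation being over $R$ and the quantization. *)

(* Defs.v *)
From mathcomp Require Import all_boot all_order all_algebra.
From mathcomp Require Import all_classical all_reals all_analysis.

Set Implicit Arguments.
Unset Strict Implicit.
Unset Printing Implicit Defensive.

Import Order.TTheory GRing.Theory Num.Theory.
Local Open Scope classical_set_scope.
Local Open Scope ring_scope.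

Lemma expn2_double (m : nat) : (2 ^ m + 2 ^ m = 2 ^ m.+1)%N.
Proof. by rewrite addnn -mul2n -expnS. Qed.

(* The recursion starts from H(1) = [1], whose next step is H(2). *)
Fixpoint hadamard (R : nzRingType) (m : nat) : 'M[R]_(2 ^ m) :=
  match m with
  | 0 => 1%:M
  | m'.+1 =>
      let H := hadamard R m' in
      castmx (expn2_double m', expn2_double m') (block_mx H H H (- H))
  end.

(* The library norm on matrices is the sup norm, hence this definition. *)
Definition sqnorm (R : realType) (d : nat) (v : 'cV[R]_d) : R :=
  \sum_(j < d) v j 0 ^+ 2.

Section Probability.
Context (disp : measure_display) (T : measurableType disp) (R : realType).

(* Stated for a set function [mu] rather than for a probability so that it also
   covers independence under a conditional probability. *)
Definition mutual_independence (mu : set T -> \bar R) (I : finType)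
    (W : I -> T -> R) : Prop :=
  forall (J : {set I}) (B : I -> set R), (forall i, measurable (B i)) ->
    mu (\bigcap_(i in [set` J]) (W i @^-1` B i)) =
    (\prod_(i in J) mu (W i @^-1` B i))%E.

(* Meaningful only when [P C] is nonzero. *)
Definition cond_prob (P : probability T R) (C : set T) : set T -> \bar R :=
  fun A => (P (A `&` C) / P C)%E.

Definition rademacher (P : probability T R) (W : {RV P >-> R}) : Prop :=
  P (W @^-1` [set 1]) = (2^-1)%:E /\ P (W @^-1` [set -1]) = (2^-1)%:E.

Definition iid_rademacher (P : probability T R) (I : finType)
    (D : I -> {RV P >-> R}) : Prop :=
  mutual_independence P (fun i => D i : T -> R) /\
  forall i, rademacher (D i).

End Probability.

(* [idx0] makes the maximum and the minimum of a vector indexed by the nonempty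
   ['I_(2 ^ m)] definable by folding from an actual coordinate. *)
Definition idx0 (m : nat) : 'I_(2 ^ m) := Ordinal (expn_gt0 2 m : 0 < 2 ^ m)%N.

Section Quantization.
Context (R : realType) (m : nat).
Implicit Types z : 'cV[R]_(2 ^ m).

Definition zmax z : R := \big[Num.max/z (idx0 m) 0]_(j < 2 ^ m) z j 0.
Definition zmin z : R := \big[Num.min/z (idx0 m) 0]_(j < 2 ^ m) z j 0.

Definition level (k : nat) z (r : nat) : R :=
  zmin z + r%:R * (zmax z - zmin z) / (k%:R - 1).

End Quantization.

Section Protocol.
Context (disp : measure_display) (T : measurableType disp) (R : realType).
Context (P : probability T R) (m n k : nat).

(* [mu] is the law of the randomness once the rotation is known, [z i] is the
   then deterministic rotated vector of client [i]. *)
Definition quantization_law (mu : set T -> \bar R) (z : 'I_n -> 'cV[R]_(2 ^ m))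
    (Y : 'I_n -> 'I_(2 ^ m) -> {RV P >-> R}) : Prop :=
  [/\ forall i j (r : nat), (r.+1 < k)%N ->
        level k (z i) r <= z i j 0 < level k (z i) r.+1 ->
        let p := (z i j 0 - level k (z i) r) /
                 (level k (z i) r.+1 - level k (z i) r) in
        mu (Y i j @^-1` [set level k (z i) r.+1]) = p%:E /\
        mu (Y i j @^-1` [set level k (z i) r]) = (1 - p)%:E,
      forall i j, z i j 0 = level k (z i) k.-1 ->
        mu (Y i j @^-1` [set z i j 0]) = 1%E
    & mutual_independence mu
        (fun ij : 'I_n * 'I_(2 ^ m) => Y ij.1 ij.2 : T -> R)].

(* For a rotation taking finitely many values, such as the randomized Hadamard
   rotation, conditioning on the values of positive probability determines the
   joint law of the rotation and the quantized vectors. *)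
Definition srk_protocol (Rot : T -> 'M[R]_(2 ^ m)) (X : 'I_n -> 'cV[R]_(2 ^ m))
    (Y : 'I_n -> 'I_(2 ^ m) -> {RV P >-> R}) : Prop :=
  forall Q : 'M[R]_(2 ^ m), (0 < P (Rot @^-1` [set Q]))%E ->
    quantization_law (cond_prob P (Rot @^-1` [set Q]))
      (fun i => Q *m X i) Y.

Definition mean_vec (X : 'I_n -> 'cV[R]_(2 ^ m)) : 'cV[R]_(2 ^ m) :=
  n%:R^-1 *: \sum_(i < n) X i.

Definition srk_estimate (Rot : T -> 'M[R]_(2 ^ m))
    (Y : 'I_n -> 'I_(2 ^ m) -> {RV P >-> R}) (w : T) : 'cV[R]_(2 ^ m) :=
  invmx (Rot w) *m mean_vec (fun i => \col_j Y i j w).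

Definition srk_error (Rot : T -> 'M[R]_(2 ^ m)) (X : 'I_n -> 'cV[R]_(2 ^ m))
    (Y : 'I_n -> 'I_(2 ^ m) -> {RV P >-> R}) : \bar R :=
  'E_P[fun w => sqnorm (srk_estimate Rot Y w - mean_vec X)].

Definition hadamard_rotation (D : 'I_(2 ^ m) -> {RV P >-> R}) (w : T) :
    'M[R]_(2 ^ m) :=
  (Num.sqrt (2 ^ m)%:R)^-1 *: (hadamard R m *m diag_mx (\row_j D j w)).

End Protocol.

(* Main.v *)
(* Given the rotation, the quantized coordinates are independent, unbiased and
   two-valued, so by orthogonality of the rotation the error is the sum of
   their variances, at most [2 ^ m * s_i ^ 2 / (4 (k - 1) ^ 2 n ^ 2)] for client
   [i], where [s_i] is the range of the rotated vector.  It remains to average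
   [s_i ^ 2 <= 2 (max^+ ^ 2 + min^- ^ 2)] over the signs.  A normalized rotated
   coordinate [g] is a Rademacher sum with a unit coefficient vector, hence
   [E exp (t g) <= exp (t ^ 2 / 2)].  With [d = 2 ^ m] and [a = 2 ln d >= 1],
   every [g] satisfies [(g^+) ^ 2 <= a + 2 exp (sqrt a * g - a)], so summing
   the exponentials over the [d] coordinates gives
   [E (max^+) ^ 2 <= a + 2 d exp (- a / 2) = a + 2]. *)

Require Import Defs.
From mathcomp Require Import all_boot all_order all_algebra.
From mathcomp Require Import all_classical all_reals all_analysis.
From mathcomp Require Import measurable_realfun ring lra.

Set Implicit Arguments.
Unset Strict Implicit.
Unset Printing Implicit Defensive.

Import Order.TTheory GRing.Theory Num.Theory.
Import numFieldNormedType.Exports.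
Local Open Scope classical_set_scope.
Local Open Scope ring_scope.

(** * Elementary inequalities for the exponential and the logarithm *)

Section RealInequalities.
Context {R : realType}.
Implicit Types x y a : R.

(** By the mean value theorem on [[0, x]]; it reduces several inequalities below to the sign of a
    derivative. *)
Lemma le_at0_of_derive_le0 (f df : R -> R) :
  (forall x, is_derive x 1 f (df x)) -> (forall x, 0 <= x -> df x <= 0) ->
  forall x, 0 <= x -> f x <= f 0.
Proof.
move=> fdf df0 x x0.
have cf : {within `[0, x], continuous f}.
  by apply: derivable_within_continuous => y _; exact: ex_derive.
have [c /[!in_itv]/= /andP[c0 _] e] := MVT_segment x0 (fun y _ => fdf y) cf.
by rewrite -subr_le0 e subr0 mulr_le0_ge0 ?df0.
Qed.

(* The sign of the derivative of [2 cosh x exp (- x ^ 2 / 2)]. *)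
Lemma expR_tanh_le x : 0 <= x -> (1 - x) * expR x - (1 + x) * expR (- x) <= 0.
Proof.
move=> x0; pose f (y : R) : R := (1 - y) * expR y - (1 + y) * expR (- y).
have -> : 0 = f 0 by rewrite /f oppr0 !expR0; ring.
apply: (@le_at0_of_derive_le0 f (fun y => y * (expR (- y) - expR y))) => // y.
  by apply: is_derive_eq; rewrite /GRing.scale/=; ring.
by move=> y0; rewrite mulr_ge0_le0// subr_le0 ler_expR; lra.
Qed.

(** Sub-Gaussian bound for one random sign: the quotient of the two sides is even and, on the
    nonnegative half-line, decreases from its value [1] at [0]. *)
Lemma expRD_expRN_le x : expR x + expR (- x) <= 2 * expR (x ^+ 2 / 2).
Proof.
wlog x0 : x / 0 <= x.
  move=> H; have [/H//|x0] := leP 0 x.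
  by rewrite addrC -{2}(opprK x) -sqrrN H//; lra.
rewrite -ler_pdivrMr ?expR_gt0// -expRN.
pose f (y : R) : R := (expR y + expR (- y)) * expR (- (y ^+ 2 / 2)).
have f0 : f 0 = 2 by rewrite /f expr0n/= mul0r oppr0 !expR0; ring.
rewrite -[leRHS]f0.
apply: (@le_at0_of_derive_le0 f (fun y =>
  ((1 - y) * expR y - (1 + y) * expR (- y)) * expR (- (y ^+ 2 / 2))) ) => // y.
  by apply: is_derive_eq; rewrite /GRing.scale/=; field.
by move=> y0; rewrite mulr_le0_ge0 ?expR_ge0// expR_tanh_le.
Qed.

(** Serves to get [2 * ln d >= 1] for [d >= 2]. Equivalently [expR (1/2) <= 2], which follows from
    [1 - 1/2 <= expR (- 1/2)]. *)
Lemma half_le_ln2 : 2^-1 <= ln 2 :> R.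
Proof.
rewrite -ler_expR lnK ?posrE//.
have := expR_ge1Dx (- 2^-1 : R); rewrite expRN => h.
have e0 := expR_gt0 (2^-1 : R).
have := ler_wpM2l (ltW e0) h; rewrite divff ?gt_eqF//; lra.
Qed.

Lemma expR_ge_quadratic x : 0 <= x -> 1 + x + x ^+ 2 / 2 <= expR x.
Proof.
move=> x0; rewrite -subr_le0.
pose f (y : R) : R := 1 + y + y ^+ 2 / 2 - expR y.
have -> : 0 = f 0 by rewrite /f expR0; ring.
apply: (@le_at0_of_derive_le0 f (fun y => 1 + y - expR y) ) => // y.
  by apply: is_derive_eq; rewrite /GRing.scale/=; field.
by move=> _; rewrite subr_le0 expR_ge1Dx.
Qed.

(* A single exponential moment, at parameter [sqrt a], stands in for an
   integration of the Gaussian tail. *)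
Lemma le_sqrt_expR a g : 1 <= a ->
  g <= Num.sqrt (a + 2 * expR (Num.sqrt a * g - a)).
Proof.
move=> a1; set s := Num.sqrt a.
have ssq : s ^+ 2 = a by rewrite sqr_sqrtr//; lra.
have s0 : 0 <= s by rewrite sqrtr_ge0.
have E0 := expR_ge0 (s * g - a).
have [gs|/ltW sg] := leP g s.
  by rewrite (le_trans gs)// ler_wsqrtr//; lra.
have g0 : 0 <= g by lra.
rewrite -[leLHS](ger0_norm g0) -sqrtr_sqr ler_wsqrtr//.
have sh0 : 0 <= s * (g - s) by rewrite mulr_ge0// subr_ge0.
have -> : s * g - a = s * (g - s) by rewrite -ssq; ring.
have := expR_ge_quadratic sh0; rewrite exprMn ssq.
(* With [t = g - s] the goal reads [a + 2 s t + t^2 <= a + 2 expR (s t)]; since [a >= 1], the term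
   [a t^2] of twice the quadratic bound absorbs [t^2]. *)
have : 1 * (g - s) ^+ 2 <= a * (g - s) ^+ 2 by rewrite ler_wpM2r ?sqr_ge0.
rewrite -ssq => ? ?; nra.
Qed.
End RealInequalities.

(** * Hadamard matrices and orthogonality of the rotation *)

Section Hadamard.
Context {R : realType}.

(** The sizes [p] and [q] are kept abstract so that the equality [e] can be eliminated, which turns
    the cast of the Hadamard recursion into the identity. *)
Lemma castmx_entry_sqr p q (e : p = q) (B : 'M[R]_p) :
  (forall i j, B i j ^+ 2 = 1) -> forall i j, castmx (e, e) B i j ^+ 2 = 1.
Proof. by case: _ / e; rewrite castmx_id. Qed.

Lemma castmx_gram p q (e : p = q) (B : 'M[R]_p) (c : R) :
  B^T *m B = c%:M -> (castmx (e, e) B)^T *m castmx (e, e) B = c%:M.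
Proof. by case: _ / e; rewrite castmx_id. Qed.

Lemma hadamard_entry_sqr m i j : hadamard R m i j ^+ 2 = 1.
Proof.
elim: m i j => [|m IH] /=.
  by move=> i j; rewrite !ord1 mxE eqxx expr1n.
apply: castmx_entry_sqr => i j.
rewrite -(splitK i) -(splitK j).
case: (fintype.split i) => i'; case: (fintype.split j) => j' /=.
- by rewrite block_mxEul.
- by rewrite block_mxEur.
- by rewrite block_mxEdl.
- by rewrite block_mxEdr mxE sqrrN.
Qed.

(** By blocks: the off-diagonal products cancel and each diagonal block is twice the previous Gram
    matrix. *)
Lemma hadamard_gram m :
  (hadamard R m)^T *m hadamard R m = (2 ^ m)%:R%:M.
Proof.
elim: m => [|m IH] /=; first by rewrite trmx1 mulmx1.
apply: castmx_gram.
have de : (2 ^ m)%:R + (2 ^ m)%:R = (2 ^ m.+1)%:R :> R.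
  by rewrite -natrD expn2_double.
have tN : (- hadamard R m)^T = - (hadamard R m)^T.
  by apply/matrixP => i j; rewrite !mxE.
rewrite tr_block_mx mulmx_block tN !(mulmxN, mulNmx) opprK !IH subrr.
rewrite -[in LHS]raddfD/= de.
by rewrite -scalar_mx_block.
Qed.

Lemma sqnormE d (v : 'cV[R]_d) : sqnorm v = (v^T *m v) 0 0.
Proof. by rewrite mxE; apply: eq_bigr => j _; rewrite mxE expr2. Qed.

Lemma sqnorm_ge0 d (v : 'cV[R]_d) : 0 <= sqnorm v.
Proof. by apply: sumr_ge0 => j _; rewrite sqr_ge0. Qed.

(** Undoing the rotation leaves the error unchanged, since [invmx Q] is the transpose of [Q]. *)
Lemma sqnorm_invmx_orthogonal d (Q : 'M[R]_d) (v : 'cV[R]_d) :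
  Q^T *m Q = 1%:M -> sqnorm (invmx Q *m v) = sqnorm v.
Proof.
move=> QQ; have [_ uQ] := mulmx1_unit QQ.
have -> : invmx Q = Q^T by rewrite -[RHS]mulmx1 -(mulmxV uQ) mulmxA QQ mul1mx.
by rewrite !sqnormE trmx_mul trmxK mulmxA -[v^T *m Q *m _]mulmxA mulmx1C//
  mulmx1.
Qed.

(** The values of the random rotation outside a null event, with [true] coding the sign [-1]. *)
Definition signed_hadamard m (s : 'I_(2 ^ m) -> bool) : 'M[R]_(2 ^ m) :=
  (Num.sqrt (2 ^ m)%:R)^-1 *:
  (hadamard R m *m diag_mx (\row_j (-1) ^+ s j)).

Lemma signed_hadamard_orthogonal m s :
  (signed_hadamard s)^T *m signed_hadamard s = 1%:M :> 'M[R]_(2 ^ m).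
Proof.
rewrite /signed_hadamard [(_ *: _)^T]linearZ/= trmx_mul.
rewrite -scalemxAl -scalemxAr scalerA.
rewrite mulmxA -[_ *m _ *m hadamard _ _]mulmxA hadamard_gram tr_diag_mx.
rewrite mul_mx_scalar -scalemxAl mulmx_diag scalerA -invfM -expr2 sqr_sqrtr//.
rewrite mulVf ?scale1r ?pnatr_eq0 ?expn_eq0//; apply/matrixP => i j.
by rewrite !mxE -expr2 sqrr_sign.
Qed.

Lemma signed_hadamard_coord m s (x : 'cV[R]_(2 ^ m)) j :
  (signed_hadamard s *m x) j 0 =
  (Num.sqrt (2 ^ m)%:R)^-1 * \sum_l (-1) ^+ s l * (hadamard R m j l * x l 0).
Proof.
rewrite /signed_hadamard -scalemxAl mxE; congr (_ * _).
rewrite mxE; apply: eq_bigr => l _.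
by rewrite mul_mx_diag !mxE; ring.
Qed.

(** Multiplying by the transposed Hadamard matrix recovers the diagonal, so conditioning on the
    rotation amounts to conditioning on the signs. *)
Lemma signed_hadamard_diag_inj m (v w : 'rV[R]_(2 ^ m)) :
  (Num.sqrt (2 ^ m)%:R)^-1 *: (hadamard R m *m diag_mx v) =
  (Num.sqrt (2 ^ m)%:R)^-1 *: (hadamard R m *m diag_mx w) -> v = w.
Proof.
have d0 : (2 ^ m)%:R != 0 :> R by rewrite pnatr_eq0 expn_eq0.
have s0 : (Num.sqrt (2 ^ m)%:R)^-1 != 0 :> R.
  by rewrite invr_eq0 sqrtr_eq0 -ltNge ltr0n expn_gt0.
move=> /(scalerI s0)/(congr1 (mulmx (hadamard R m)^T)).
rewrite !mulmxA hadamard_gram !mul_scalar_mx => /(scalerI d0)/matrixP vw.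
by apply/rowP => j; have := vw j j; rewrite !mxE eqxx !mulr1n.
Qed.
End Hadamard.

(** * Averages over sign patterns and the range of a rotated vector *)

Section SignAverages.
Context {R : realType}.

(** Up to the factor [2 ^+ #|I|] the sum is an expectation over independent signs: it factors over
    the coordinates, and the one-sign estimate bounds each factor. *)
Lemma sum_signs_expR_le (I : finType) (c : I -> R) :
  \sum_(s : {ffun I -> bool}) expR (\sum_i (-1) ^+ s i * c i) <=
  2 ^+ #|I| * expR ((\sum_i c i ^+ 2) / 2).
Proof.
under eq_bigr do rewrite expR_sum.
rewrite -(bigA_distr_bigA (fun i (b : bool) => expR ((-1) ^+ b * c i)))/=.
rewrite mulr_suml expR_sum -prodr_const -big_split/=.
apply: ler_prod => i _; rewrite big_bool/= expr1 expr0 mulN1r mul1r.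
by rewrite addr_ge0 ?expR_ge0//= addrC expRD_expRN_le.
Qed.

(** At parameter [Num.sqrt a] each exponential averages to at most [expR (- a) * expR (a / 2)],
    which is the inverse of [#|J|] by the choice of [a]; the [#|J|] terms add up to at most [1],
    hence the [2] after doubling. *)
Lemma sum_signs_softmax_le (I J : finType) (c : J -> I -> R) (a : R) :
  (0 < #|J|)%N -> (forall j, \sum_i c j i ^+ 2 = 1) -> a = 2 * ln #|J|%:R ->
  \sum_(s : {ffun I -> bool})
    (a + 2 * \sum_j expR (Num.sqrt a * (\sum_i (-1) ^+ s i * c j i) - a)) <=
  2 ^+ #|I| * (a + 2).
Proof.
move=> J0 c1 aE.
have J0' : (0 : R) < #|J|%:R by rewrite ltr0n.
have a0 : 0 <= a by rewrite aE mulr_ge0// ln_ge0// ler1n.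
have ea : expR (- a) * expR (a / 2) = #|J|%:R^-1.
  rewrite -expRD (_ : - a + a / 2 = - ln #|J|%:R); last by rewrite aE; field.
  by rewrite expRN lnK.
rewrite big_split/= sumr_const card_ffun card_bool -[a *+ _]mulr_natl.
rewrite natrX mulrDr lerD2l -mulr_sumr exchange_big/= [leRHS]mulrC ler_wpM2l//.
have -> : 2 ^+ #|I| = \sum_(j : J) expR (- a) * (2 ^+ #|I| * expR (a / 2)).
  rewrite sumr_const -[RHS]mulr_natr mulrCA ea -mulrA mulVf ?mulr1//.
  by rewrite gt_eqF.
apply: ler_sum => j _.
under eq_bigr do rewrite addrC expRD mulr_sumr.
rewrite -mulr_sumr ler_wpM2l ?expR_ge0//.
have -> : a / 2 = (\sum_i (Num.sqrt a * c j i) ^+ 2) / 2.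
  under eq_bigr do rewrite exprMn sqr_sqrtr//.
  by rewrite -mulr_sumr c1 mulr1.
apply: le_trans (sum_signs_expR_le _).
by apply: ler_sum => s _; under eq_bigr do rewrite mulrCA.
Qed.

(** As [u - v] is at most the sum of the two square roots [s] and [t], this comes down to
    [(s + t)^2 <= 2 (s^2 + t^2)]. *)
Lemma sqrB_le_of_sqrt (u v p q : R) : 0 <= p -> 0 <= q -> v <= u ->
  u <= Num.sqrt p -> - v <= Num.sqrt q -> (u - v) ^+ 2 <= 2 * (p + q).
Proof.
move=> p0 q0 vu up vq.
have := sqr_sqrtr p0; have := sqr_sqrtr q0.
have := sqrtr_ge0 p; have := sqrtr_ge0 q.
set s := Num.sqrt p in up *; set t := Num.sqrt q in vq * => t0 s0 <- <-.
have h : (u - v) ^+ 2 <= (s + t) ^+ 2.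
  by rewrite ler_sqr ?nnegrE; lra.
apply: (le_trans h); rewrite -subr_ge0.
by rewrite (_ : _ - _ = (s - t) ^+ 2) ?sqr_ge0//; ring.
Qed.

Lemma zmax_le m (z : 'cV[R]_(2 ^ m)) b : (forall j, z j 0 <= b) -> zmax z <= b.
Proof. by move=> zb; apply: bigmax_le. Qed.

Lemma le_zmin m (z : 'cV[R]_(2 ^ m)) b : (forall j, b <= z j 0) -> b <= zmin z.
Proof. by move=> zb; apply: le_bigmin. Qed.

Lemma zmin_le m (z : 'cV[R]_(2 ^ m)) j : zmin z <= z j 0.
Proof. exact: (bigmin_le_cond _ (fun j => z j 0)). Qed.

Lemma le_zmax m (z : 'cV[R]_(2 ^ m)) j : z j 0 <= zmax z.
Proof. exact: (le_bigmax_cond _ (fun j => z j 0)). Qed.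

Lemma zmin_le_zmax m (z : 'cV[R]_(2 ^ m)) : zmin z <= zmax z.
Proof. exact: le_trans (zmin_le z (idx0 m)) (le_zmax z _). Qed.

(* Bounding the maximum and the minimum separately, rather than [max `|z j|],
   keeps the factor [2 ^ m] instead of [2 ^ m.+1] in the union bound. *)
Lemma sum_signed_hadamard_range_le m (x : 'cV[R]_(2 ^ m)) : (0 < m)%N ->
  \sum_(s : {ffun 'I_(2 ^ m) -> bool})
    (zmax (signed_hadamard s *m x) - zmin (signed_hadamard s *m x)) ^+ 2 <=
  2 ^+ (2 ^ m) *
    (4 * (2 * ln (2 ^ m)%:R + 2) / (2 ^ m)%:R * sqnorm x).
Proof.
move=> m0; set d : R := (2 ^ m)%:R; set a := 2 * ln d.
have d0 : 0 < d by rewrite ltr0n expn_gt0.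
have a1 : 1 <= a.
  rewrite /a; suff : 2^-1 <= ln d by lra.
  rewrite (le_trans half_le_ln2)// ler_ln ?posrE// /d ler_nat.
  by rewrite -{1}(expn1 2) leq_exp2l.
(* The zero vector is set apart because the coefficients below are normalized by the norm of [x]. *)
have [x0|] := eqVneq (sqnorm x) 0.
  have xE : x = 0.
    apply/colP => j; rewrite mxE; apply/eqP; rewrite -sqrf_eq0; apply/eqP.
    apply: (psumr_eq0P _ x0) => // i _; exact: sqr_ge0.
  have z0 s : zmax (signed_hadamard s *m (0 : 'cV_(2 ^ m))) = 0 :> R.
    apply/le_anti; rewrite mulmx0; apply/andP; split.
      by apply: zmax_le => j; rewrite mxE.
    by have := le_zmax (0 : 'cV[R]_(2 ^ m)) (idx0 m); rewrite mxE.
  have z1 s : zmin (signed_hadamard s *m (0 : 'cV_(2 ^ m))) = 0 :> R.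
    apply/le_anti; rewrite mulmx0; apply/andP; split; last first.
      by apply: le_zmin => j; rewrite mxE.
    by have := zmin_le (0 : 'cV[R]_(2 ^ m)) (idx0 m); rewrite mxE.
  rewrite x0 !mulr0 big1// => s _.
  by rewrite xE z0 z1 subrr expr0n.
move=> x0; have {x0} x0 : 0 < sqnorm x by rewrite lt_def x0 sqnorm_ge0.
set N := Num.sqrt (sqnorm x).
have N0 : 0 < N by rewrite sqrtr_gt0.
have Nsq : N ^+ 2 = sqnorm x by rewrite sqr_sqrtr// ltW.
(* Coefficients of the rotated coordinate [j] in units of [N / sqrt d]; they form a unit vector
   because Hadamard entries square to [1]. *)
pose c j l := hadamard R m j l * (x l 0 / N).
have c1 j : \sum_l c j l ^+ 2 = 1.
  under eq_bigr do rewrite exprMn hadamard_entry_sqr mul1r expr_div_n.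
  by rewrite -mulr_suml Nsq divff ?gt_eqF.
(* The negated rows serve for the minimum, whose opposite is a maximum of negated coordinates. *)
have cN1 j : \sum_l (- c j l) ^+ 2 = 1.
  by rewrite -[RHS](c1 j); under eq_bigr do rewrite sqrrN.
pose B (c : 'I_(2 ^ m) -> 'I_(2 ^ m) -> R) (s : {ffun 'I_(2 ^ m) -> bool}) :=
  a + 2 * \sum_j expR (Num.sqrt a * (\sum_l (-1) ^+ s l * c j l) - a).
have B0 c' s : 0 <= B c' s.
  by rewrite addr_ge0 ?(le_trans ler01 a1)// mulr_ge0// sumr_ge0.
(* Bounding one exponential by the sum of all of them makes the bound uniform in [j]. *)
have gB (c' : 'I_(2 ^ m) -> 'I_(2 ^ m) -> R) (s : {ffun 'I_(2 ^ m) -> bool}) j :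
    \sum_l (-1) ^+ s l * c' j l <= Num.sqrt (B c' s).
  rewrite (le_trans (le_sqrt_expR _ a1))// ler_wsqrtr// lerD2l ler_wpM2l//.
  by rewrite [leRHS](bigD1 j)//= lerDl sumr_ge0// => *; exact: expR_ge0.
set r := (Num.sqrt d)^-1 * N.
have r0 : 0 < r by rewrite mulr_gt0// invr_gt0 sqrtr_gt0.
have zE s j : (signed_hadamard s *m x) j 0 = r * \sum_l (-1) ^+ s l * c j l.
  rewrite signed_hadamard_coord -/d /r -mulrA; congr (_ * _).
  rewrite mulr_sumr; apply: eq_bigr => l _.
  by rewrite /c; field; rewrite gt_eqF.
have rangeB (s : {ffun 'I_(2 ^ m) -> bool}) :
    (zmax (signed_hadamard s *m x) - zmin (signed_hadamard s *m x)) ^+ 2 <=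
    r ^+ 2 * (2 * (B c s + B (fun j l => - c j l) s)).
  rewrite -ler_pdivrMl ?exprn_gt0// -exprVn -exprMn mulrBr.
  apply: sqrB_le_of_sqrt => //.
  - by rewrite ler_wpM2l ?invr_ge0 ?(ltW r0)// zmin_le_zmax.
  - by rewrite ler_pdivrMl//; apply: zmax_le => j; rewrite zE ler_pM2l.
  - rewrite -mulrN ler_pdivrMl// lerNl; apply: le_zmin => j.
    rewrite lerNl zE -mulrN ler_pM2l// (le_trans _ (gB _ s j))//.
    by rewrite -sumrN; apply: ler_sum => l _; rewrite mulrN.
apply: (le_trans (ler_sum _ (fun s _ => rangeB s))).
rewrite -mulr_sumr -mulr_sumr big_split/=.
have cI : #|'I_(2 ^ m)| = (2 ^ m)%N by rewrite card_ord.
have J0 : (0 < #|'I_(2 ^ m)|)%N by rewrite cI expn_gt0.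
have aE : a = 2 * ln #|'I_(2 ^ m)|%:R by rewrite cI.
have S1 := sum_signs_softmax_le J0 c1 aE.
have S2 := sum_signs_softmax_le J0 cN1 aE.
rewrite -!/(B _ _) cI in S1 S2.
(* Here [r ^+ 2] is [sqnorm x / d], and the [4] collects the factor [2] of [sqrB_le_of_sqrt] and the
   two one-sided bounds. *)
have -> : 2 ^+ (2 ^ m) * (4 * (a + 2) / d * sqnorm x) =
    r ^+ 2 * (2 * (2 ^+ (2 ^ m) * (a + 2) + 2 ^+ (2 ^ m) * (a + 2))).
  rewrite /r exprMn exprVn sqr_sqrtr ?(ltW d0)// Nsq.
  by field; rewrite gt_eqF.
by rewrite ler_wpM2l ?sqr_ge0// ler_wpM2l// lerD.
Qed.
End SignAverages.

(** * Integration tools and second moments of centered indicators *)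

Section ProbabilityTools.
Context (disp : measure_display) (T : measurableType disp) (R : realType).
Context (P : probability T R).
Import HBNNSimple.

(* The smaller function need not be measurable: its integral is a supremum over
   simple functions below it. *)
Lemma ae_le_ge0_integral (f g : T -> \bar R) :
  (forall w, 0 <= f w)%E -> (forall w, 0 <= g w)%E ->
  measurable_fun [set: T] g ->
  {ae P, forall w, f w <= g w}%E -> (\int[P]_w f w <= \int[P]_w g w)%E.
Proof.
move=> f0 g0 mg fg; rewrite ge0_integralTE//.
apply: ge_ereal_sup => _ [h hf <-].
have -> : sintegral P h = (\int[P]_w (h w)%:E)%E.
  by rewrite integral_nnsfun// patch_setT.
apply: ae_ge0_le_integral => //.
- by move=> w _; rewrite lee_fin.
- exact/measurable_EFinP.
- by apply: filterS fg => w fgw _; exact: le_trans (hf w) fgw.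
Qed.

Lemma integrable_indic_in (A E : set T) : measurable A -> measurable E ->
  P.-integrable A (EFin \o \1_E).
Proof.
move=> mA mE.
exact: (integrableS measurableT mA (@subsetT _ _) (integrable_indic P mE)).
Qed.

Lemma integrable_cst_in (A : set T) (c : R) : measurable A ->
  P.-integrable A (EFin \o (fun=> c)).
Proof. exact: finite_measure_integrable_cst. Qed.

Lemma integrable_EFinD (A : set T) (f g : T -> R) : measurable A ->
  P.-integrable A (EFin \o f) -> P.-integrable A (EFin \o g) ->
  P.-integrable A (EFin \o (fun w => f w + g w)).
Proof.
move=> mA fi gi.
rewrite (_ : _ \o _ = (fun w => (EFin \o f) w + (EFin \o g) w)%E)//.
exact: integrableD.
Qed.

Lemma integrable_EFinZ (A : set T) (c : R) (f : T -> R) : measurable A ->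
  P.-integrable A (EFin \o f) -> P.-integrable A (EFin \o (fun w => c * f w)).
Proof.
move=> mA fi; rewrite (_ : _ \o _ = (fun w => c%:E * (EFin \o f) w)%E)//.
exact: integrableZl.
Qed.

Lemma integrable_EFin_sum (A : set T) (I : finType) (f : I -> T -> R) :
  measurable A -> (forall i, P.-integrable A (EFin \o f i)) ->
  P.-integrable A (EFin \o (fun w => \sum_i f i w)).
Proof.
move=> mA fi; rewrite (_ : _ \o _ = (fun w => \sum_i (EFin \o f i) w)).
  exact: integrable_sum.
by apply/funext => w /=; rewrite sumEFin.
Qed.

Lemma Rintegral_indic (A E : set T) : measurable A -> measurable E ->
  \int[P]_(w in A) \1_E w = fine (P (E `&` A)).
Proof. by move=> mA mE; rewrite /Rintegral integral_indic. Qed.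

Lemma Rintegral_sum (A : set T) (I : finType) (f : I -> T -> R) :
  measurable A -> (forall i, P.-integrable A (EFin \o f i)) ->
  \int[P]_(w in A) (\sum_i f i w) = \sum_i \int[P]_(w in A) f i w.
Proof.
move=> mA intf; rewrite /Rintegral.
under eq_integral do rewrite -sumEFin.
rewrite (integral_sum mA intf) -sum_fine// => i _.
exact: integrable_fin_num.
Qed.

(** In use, [p] is the conditional probability of [E] given an event, on which this function then
    has integral zero. *)
Definition centered (E : set T) (p : R) (w : T) : R := \1_E w - p.

Lemma centered_mulE E F p r w : centered E p w * centered F r w =
  \1_(E `&` F) w + (- r) * \1_E w + (- p) * \1_F w + p * r.
Proof. by rewrite /centered indicI/=; ring. Qed.

Lemma integrable_centered_mul A E F p r :
  measurable A -> measurable E -> measurable F ->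
  P.-integrable A (EFin \o (fun w => centered E p w * centered F r w)).
Proof.
move=> mA mE mF.
under [EFin \o _]eq_fun do rewrite /= centered_mulE.
have mEF : measurable (E `&` F) by exact: measurableI.
apply: (@integrable_EFinD _ (fun w =>
  \1_(E `&` F) w + (- r) * \1_E w + (- p) * \1_F w) (fun=> p * r)) => //.
  apply: integrable_EFinD => //.
    apply: integrable_EFinD => //; first exact: integrable_indic_in.
    exact/integrable_EFinZ/integrable_indic_in.
  exact/integrable_EFinZ/integrable_indic_in.
exact: integrable_cst_in.
Qed.

Lemma Rintegral_centered_mul A E F p r :
  measurable A -> measurable E -> measurable F ->
  \int[P]_(w in A) (centered E p w * centered F r w) =
  fine (P (E `&` F `&` A)) - r * fine (P (E `&` A)) - p * fine (P (F `&` A)) +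
  p * r * fine (P A).
Proof.
move=> mA mE mF; have mEF : measurable (E `&` F) by exact: measurableI.
under eq_Rintegral do rewrite centered_mulE.
have iE := integrable_EFinZ (- r) mA (integrable_indic_in mA mE).
have iF := integrable_EFinZ (- p) mA (integrable_indic_in mA mF).
have iEF := integrable_indic_in mA mEF.
have i1 := integrable_EFinD mA iEF iE.
have i2 := integrable_EFinD mA i1 iF.
rewrite RintegralD//; last exact: integrable_cst_in.
rewrite Rintegral_cst//.
rewrite RintegralD//.
rewrite RintegralD//.
rewrite !RintegralZl//; try exact: integrable_indic_in.
by rewrite !Rintegral_indic//; ring.
Qed.

(* Pairwise independence kills the cross terms, which leaves the variances. *)
Lemma integral_sqr_sum_centered (A : set T) (I : finType) (c p : I -> R)
    (E : I -> set T) (q : R) :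
  measurable A -> (forall i, measurable (E i)) ->
  P A = q%:E -> (forall i, P (E i `&` A) = (p i * q)%:E) ->
  (forall i j, i != j -> P (E i `&` E j `&` A) = (p i * p j * q)%:E) ->
  (\int[P]_(w in A) ((\sum_i c i * centered (E i) (p i) w) ^+ 2)%:E =
   (q * \sum_i c i ^+ 2 * (p i * (1 - p i)))%:E)%E.
Proof.
move=> mA mE PA PE PEE.
pose X i j w := c i * c j * (centered (E i) (p i) w * centered (E j) (p j) w).
have iX i j : P.-integrable A (EFin \o X i j).
  exact/integrable_EFinZ/integrable_centered_mul.
have iSX i : P.-integrable A (EFin \o (fun w => \sum_j X i j w)).
  exact: integrable_EFin_sum.
have XE w : (\sum_i c i * centered (E i) (p i) w) ^+ 2 = \sum_i \sum_j X i j w.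
  rewrite expr2 big_distrlr/=; apply: eq_bigr => i _; apply: eq_bigr => j _.
  by rewrite /X; ring.
have iX2 : P.-integrable A (EFin \o (fun w => \sum_i \sum_j X i j w)).
  exact: integrable_EFin_sum.
under eq_integral do rewrite XE.
rewrite -[LHS]fineK; last exact: integrable_fin_num.
rewrite -[fine _]/(\int[P]_(w in A) (\sum_i \sum_j X i j w))%R.
congr (_%:E); rewrite Rintegral_sum// mulr_sumr; apply: eq_bigr => i _.
rewrite Rintegral_sum// (bigD1 i)//= big1 => [|j ji].
  rewrite addr0 RintegralZl//; last exact: integrable_centered_mul.
  by rewrite Rintegral_centered_mul// setIid PE PA/=; ring.
rewrite RintegralZl//; last exact: integrable_centered_mul.
by rewrite Rintegral_centered_mul// PEE 1?eq_sym// !PE PA/=; ring.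
Qed.

End ProbabilityTools.

(** * Position of a coordinate among the quantization levels *)

Section Quantization.
Context (R : realType) (m k : nat).
Hypothesis hk : (1 < k)%N.
Implicit Types z : 'cV[R]_(2 ^ m).

Let k1_gt0 : 0 < k%:R - 1 :> R.
Proof. by rewrite subr_gt0 ltr1n. Qed.

Lemma level_last z : level k z k.-1 = zmax z.
Proof.
rewrite /level -subn1 natrB ?(ltnW hk)// mulrAC divff ?gt_eqF// mul1r.
by rewrite addrC subrK.
Qed.

Lemma level_step z r :
  level k z r.+1 - level k z r = (zmax z - zmin z) / (k%:R - 1).
Proof. by rewrite /level -natr1; field; rewrite gt_eqF. Qed.

(** A coordinate below the last level, which is the maximum, has a least level index strictly above
    it; this index is not [0], since level [0] is the minimum, and [r] is its predecessor. *)
Lemma level_cases z j : z j 0 = level k z k.-1 \/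
  exists2 r, (r.+1 < k)%N & level k z r <= z j 0 < level k z r.+1.
Proof.
have := le_zmax z j; rewrite le_eqVlt -level_last => /predU1P[->|zlast].
  by left.
right; have ex : exists r, z j 0 < level k z r by exists k.-1.
case: (ex_minnP ex) => -[|r] zr rmin.
  by move: zr; rewrite /level !mul0r addr0 ltNge zmin_le.
exists r; first by rewrite -[k]prednK ?ltnS ?rmin// ltnW.
rewrite zr andbT leNgt; apply/negP => /rmin.
by rewrite ltnn.
Qed.

End Quantization.

(** * Quantization error given the rotation *)

Section ConditionalError.
Context (disp : measure_display) (T : measurableType disp) (R : realType).
Context (P : probability T R).

Lemma cond_probK (A B : set T) (q : R) :
  measurable A -> measurable B -> P A = q%:E -> 0 < q ->
  P (B `&` A) = (cond_prob P A B * q%:E)%E.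
Proof.
move=> mA mB PA q0; rewrite /cond_prob PA inver gt_eqF// -muleA -EFinM.
by rewrite mulVf ?gt_eqF// mule1.
Qed.

Lemma measurable_RV_preimage1 (Y : {RV P >-> R}) b :
  measurable (Y @^-1` [set b]).
Proof. by rewrite -[X in measurable X]setTI; exact: measurable_funP. Qed.

Section TwoPoint.
Variables (m k : nat) (hk : (1 < k)%N) (z : 'cV[R]_(2 ^ m)) (j : 'I_(2 ^ m)).
Variables (Y : {RV P >-> R}) (A : set T) (q : R).
Hypotheses (mA : measurable A) (PA : P A = q%:E) (q_gt0 : 0 < q).

(* In the degenerate case [Y = z j 0] the second point is a dummy of
   probability [0]. *)
Lemma quantization_two_point :
  (forall r : nat, (r.+1 < k)%N -> level k z r <= z j 0 < level k z r.+1 ->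
     let p := (z j 0 - level k z r) / (level k z r.+1 - level k z r) in
     cond_prob P A (Y @^-1` [set level k z r.+1]) = p%:E /\
     cond_prob P A (Y @^-1` [set level k z r]) = (1 - p)%:E) ->
  (z j 0 = level k z k.-1 -> cond_prob P A (Y @^-1` [set z j 0]) = 1%E) ->
  exists abp : R * R * R, let: (a, b, p) := abp in
    [/\ a != b, cond_prob P A (Y @^-1` [set b]) = p%:E,
        cond_prob P A (Y @^-1` [set a]) = (1 - p)%:E,
        z j 0 = a + p * (b - a) &
        (b - a) ^+ 2 * (p * (1 - p)) <=
          (zmax z - zmin z) ^+ 2 / (4 * (k%:R - 1) ^+ 2)].
Proof.
have k0 : 0 < k%:R - 1 :> R by rewrite subr_gt0 ltr1n.
move=> Hlt Hlast; have [zlast|[r rk zr]] := level_cases hk z j.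
  exists (z j 0, z j 0 + 1, 0); split.
  - by rewrite -subr_eq0 opprD addrA subrr sub0r oppr_eq0 oner_eq0.
  - have m1 := measurable_RV_preimage1 Y (z j 0 + 1).
    have m0 := measurable_RV_preimage1 Y (z j 0).
    have P0 := cond_probK mA m0 PA q_gt0.
    rewrite (Hlast zlast) mul1e -PA in P0.
    rewrite /cond_prob (_ : P _ = 0%E) ?mul0e//.
    have mI0 : measurable (Y @^-1` [set z j 0] `&` A) by exact: measurableI.
    have mI1 : measurable (Y @^-1` [set z j 0 + 1] `&` A) by exact: measurableI.
    (* The point [z j 0] already carries the whole mass of [A], so the disjoint event of the dummy
       point has probability [0] within [A]. *)
    have PU : (P (Y @^-1` [set z j 0%R] `&` A) +
        P (Y @^-1` [set (z j 0 + 1)%R] `&` A) <= P A)%E.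
      rewrite -measureU//; last first.
        rewrite -subset0 => w [[/= -> _] [/= e _]]; move/eqP: e.
        by rewrite -subr_eq0 opprD addrA subrr sub0r oppr_eq0 oner_eq0.
      by rewrite le_measure ?inE//; [exact: measurableU|by move=> w [[]|[]]].
    move: PU; rewrite P0 PA -leeBrDl// subee// => PU.
    by apply/le_anti; rewrite PU measure_ge0.
  - by rewrite subr0 Hlast.
  - by rewrite mul0r addr0.
  - by rewrite mul0r mulr0 divr_ge0 ?sqr_ge0// mulr_ge0 ?sqr_ge0.
have [Hb Ha] := Hlt r rk zr.
set p := (_ / _) in Hb Ha.
have /andP[az zb] := zr.
have ab : 0 < level k z r.+1 - level k z r by rewrite subr_gt0 (le_lt_trans az).
exists (level k z r, level k z r.+1, p); split => //.
- by rewrite lt_eqF// -subr_gt0.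
- by rewrite /p mulfVK ?gt_eqF// addrC subrK.
- rewrite level_step// expr_div_n [4 * _]mulrC [(_ * 4)^-1]invfM [leRHS]mulrA.
  rewrite ler_wpM2l ?divr_ge0 ?sqr_ge0//.
  (* This gives [p (1 - p) <= 1/4], the source of the [4] in the denominator. *)
  have := sqr_ge0 (p - 2^-1); nra.
Qed.

End TwoPoint.

Lemma sqnorm_mean_vecB (m n : nat) (u v : 'I_n -> 'cV[R]_(2 ^ m)) :
  sqnorm (mean_vec u - mean_vec v) =
  \sum_j (\sum_i n%:R^-1 * (u i j 0 - v i j 0)) ^+ 2.
Proof.
apply: eq_bigr => j _; congr (_ ^+ 2).
by rewrite /mean_vec -scalerBr -sumrB mxE summxE mulr_sumr;
  apply: eq_bigr => i _; rewrite !mxE.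
Qed.

(** In the application [A] fixes the rotation. Almost everywhere on [A] each entry is one of two
    points, so the error agrees there with a polynomial [h] in indicators, whose integral needs only
    conditional probabilities. The integral over [A] is not normalized, hence the factor [q]. *)
Lemma quantization_error (m n k : nat) (z : 'I_n -> 'cV[R]_(2 ^ m))
    (Y : 'I_n -> 'I_(2 ^ m) -> {RV P >-> R}) (A : set T) (q : R) :
  (1 < k)%N -> measurable A -> P A = q%:E -> 0 < q ->
  quantization_law k (cond_prob P A) z Y ->
  exists h : T -> R, [/\ measurable_fun [set: T] h, forall w, 0 <= h w,
    {ae P, forall w, A w ->
       sqnorm (mean_vec (fun i => \col_j Y i j w) - mean_vec z) = h w} &
    (\int[P]_(w in A) (h w)%:E <=
     (q * ((2 ^ m)%:R / (n%:R ^+ 2 * (4 * (k%:R - 1) ^+ 2)) *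
       \sum_i (zmax (z i) - zmin (z i)) ^+ 2))%:E)%E].
Proof.
move=> hk mA PA q0 [Hlt Hlast Hind].
have /choice[abp Habp] (ij : 'I_n * 'I_(2 ^ m)) := quantization_two_point
  hk mA PA q0 (Hlt ij.1 ij.2) (Hlast ij.1 ij.2).
pose a ij := (abp ij).1.1; pose b ij := (abp ij).1.2; pose p ij := (abp ij).2.
have {}Habp ij : [/\ a ij != b ij,
    cond_prob P A (Y ij.1 ij.2 @^-1` [set b ij]) = (p ij)%:E,
    cond_prob P A (Y ij.1 ij.2 @^-1` [set a ij]) = (1 - p ij)%:E,
    z ij.1 ij.2 0 = a ij + p ij * (b ij - a ij) &
    (b ij - a ij) ^+ 2 * (p ij * (1 - p ij)) <=
      (zmax (z ij.1) - zmin (z ij.1)) ^+ 2 / (4 * (k%:R - 1) ^+ 2)].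
  by have := Habp ij; rewrite /a /b /p; case: (abp ij) => -[].
pose E (ij : 'I_n * 'I_(2 ^ m)) : set T := Y ij.1 ij.2 @^-1` [set b ij].
have mE ij : measurable (E ij) by exact: measurable_RV_preimage1.
pose c ij := n%:R^-1 * (b ij - a ij).
exists (fun w =>
  \sum_j (\sum_i c (i, j) * centered (E (i, j)) (p (i, j)) w) ^+ 2).
have mh j : measurable_fun [set: T]
    (fun w => (\sum_i c (i, j) * centered (E (i, j)) (p (i, j)) w) ^+ 2).
  apply: measurable_funX; apply: measurable_sum => i.
  by apply: measurable_funM => //; exact: measurable_funB.
split.
- exact: measurable_sum.
- by move=> w; apply: sumr_ge0 => j _; rewrite sqr_ge0.
(* Given [A], the two points have total probability [(1 - p) + p = 1], so the rest of [A] is a null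
   set. *)
- have ae2 : {ae P, forall w, forall ij, A w ->
      Y ij.1 ij.2 w = a ij \/ Y ij.1 ij.2 w = b ij}.
    apply: filter_forall => ij.
    have [ab Pb Pa _ _] := Habp ij.
    set Ea := Y ij.1 ij.2 @^-1` [set a ij].
    have mEa : measurable Ea by exact: measurable_RV_preimage1.
    have mU : measurable (Ea `|` E ij) by exact: measurableU.
    exists (A `\` (Ea `|` E ij)); split; first exact: measurableD.
      have mEaA : measurable (Ea `&` A) by exact: measurableI.
      have mEA : measurable (E ij `&` A) by exact: measurableI.
      have PD : P (A `\` (Ea `|` E ij)) =
          (P A - (P (Ea `&` A) + P (E ij `&` A)))%E.
        rewrite measureD//; last by rewrite ltey_eq fin_num_measure.
        rewrite setIC setIUl measureU//.
        rewrite -subset0 => w [[/= Yw _] [/= Yw' _]].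
        by case/eqP: ab; rewrite -Yw -Yw'.
      apply: (etrans PD).
      rewrite (cond_probK mA mEa PA q0) Pa (cond_probK mA (mE ij) PA q0) Pb PA.
      by rewrite -!EFinM; congr (_%:E); ring.
    move=> w /= /not_implyP[Aw Yw]; split => // -[Yw'|Yw'];
      apply: Yw; by [left|right].
  apply: filterS ae2 => w Hw Aw.
  rewrite sqnorm_mean_vecB; apply: eq_bigr => j _; congr (_ ^+ 2).
  apply: eq_bigr => i _; rewrite mxE /c -mulrA; congr (_ * _).
  (* The deviation is [- p (b - a)] at [a] and [(1 - p) (b - a)] at [b], that is [b - a] times the
     centered indicator of [b]. *)
  have [ab _ _ /= -> _] := Habp (i, j).
  rewrite /centered indicE; have [/= Yw|/= Yw] := Hw (i, j) Aw; rewrite Yw.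
    rewrite memNset/=; last by rewrite /E/= Yw; exact/eqP.
    by ring.
  by rewrite mem_set//=; ring.
have PE ij : P (E ij `&` A) = (p ij * q)%:E.
  by have [_ e _ _ _] := Habp ij; rewrite (cond_probK mA _ PA q0)// e.
under eq_integral do rewrite -sumEFin.
rewrite ge0_integral_sum//; last 2 first.
- by move=> j; apply: measurable_funTS; exact/measurable_EFinP.
- by move=> j w _; rewrite lee_fin sqr_ge0.
under eq_bigr => j _.
  rewrite (@integral_sqr_sum_centered _ _ _ P A _ (fun i => c (i, j))
    (fun i => p (i, j)) (fun i => E (i, j)) q)//; last first.
    move=> i i' ii'.
    have ij' : (i, j) != (i', j) by apply: contra ii' => /eqP[->].
    rewrite (cond_probK mA _ PA q0); last exact: measurableI.
    (* A two-element index set extracts the pairwise independence of two clients at coordinate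
       [j]. *)
    have := Hind [set (i, j); (i', j)]%SET (fun ij => [set b ij])
      (fun=> measurable_set1 _).
    rewrite big_setU1 ?inE//= big_set1/=.
    have [_ -> _ _ _] := Habp (i, j); have [_ -> _ _ _] := Habp (i', j).
    rewrite (_ : \bigcap_(_ in _) _ = E (i, j) `&` E (i', j)).
      by move=> ->; rewrite -!EFinM.
    apply/seteqP; split => w.
      by move=> Hw; split; apply: Hw; rewrite /= !inE eqxx// orbT.
    by move=> [H1 H2] ij /=; rewrite !inE => /orP[]/eqP ->.
  over.
rewrite sumEFin lee_fin -mulr_sumr ler_wpM2l ?(ltW q0)//.
(* The variance bound does not depend on the coordinate [j], whence the factor [2 ^ m]. *)
have -> : (2 ^ m)%:R / (n%:R ^+ 2 * (4 * (k%:R - 1) ^+ 2)) *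
       \sum_i (zmax (z i) - zmin (z i)) ^+ 2 =
     \sum_(j < 2 ^ m) \sum_i n%:R^-1 ^+ 2 *
       ((zmax (z i) - zmin (z i)) ^+ 2 / (4 * (k%:R - 1) ^+ 2)).
  rewrite sumr_const card_ord -[RHS]mulr_natl -mulrA; congr (_ * _).
  rewrite mulr_sumr; apply: eq_bigr => i _.
  by rewrite invfM exprVn; ring.
apply: ler_sum => j _; apply: ler_sum => i _.
rewrite /c exprMn -mulrA ler_wpM2l ?sqr_ge0//.
by have [] := Habp (i, j).
Qed.

End ConditionalError.

(** * Events fixing the random signs *)

Section RandomSigns.
Context (disp : measure_display) (T : measurableType disp) (R : realType).
Context (P : probability T R) (m : nat) (D : 'I_(2 ^ m) -> {RV P >-> R}).

(** The intersection over the full index set has the shape found in [mutual_independence], so that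
    the product formula applies directly. *)
Definition sign_event (s : {ffun 'I_(2 ^ m) -> bool}) : set T :=
  \bigcap_(j in [set` [set: 'I_(2 ^ m)]%SET]) (D j @^-1` [set (-1) ^+ s j]).

Lemma sign_eventP (s : {ffun 'I_(2 ^ m) -> bool}) w :
  sign_event s w <-> forall j, D j w = (-1) ^+ s j.
Proof.
split=> [Hw j|Hw j _]; last exact: Hw.
by apply: Hw; rewrite /= inE.
Qed.

Lemma measurable_sign_event s : measurable (sign_event s).
Proof.
apply: fin_bigcap_measurable; first exact: finite_finset.
by move=> j _; exact: measurable_RV_preimage1.
Qed.

Lemma sign_eventE (s : {ffun 'I_(2 ^ m) -> bool}) :
  hadamard_rotation D @^-1` [set signed_hadamard s] = sign_event s.
Proof.
apply/seteqP; split => w.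
  move=> /signed_hadamard_diag_inj/rowP Dw; apply/sign_eventP => j.
  by have := Dw j; rewrite !mxE.
move=> /sign_eventP Dw /=; rewrite /hadamard_rotation /signed_hadamard.
congr (_ *: (_ *m diag_mx _)); apply/rowP => j.
by rewrite !mxE Dw.
Qed.

Hypothesis hD : iid_rademacher D.

Lemma rademacher_sign j (b : bool) : P (D j @^-1` [set (-1) ^+ b]) = 2^-1%:E.
Proof. by have [_ /(_ j)[]] := hD; case: b; rewrite ?expr1 ?expr0. Qed.

Lemma prob_sign_event s : P (sign_event s) = (2 ^- (2 ^ m))%:E.
Proof.
have [Hind _] := hD.
rewrite (Hind _ (fun j => [set (-1) ^+ s j]) (fun=> measurable_set1 _)).
under eq_bigr do rewrite rademacher_sign.
rewrite prodEFin prodr_const cardsT card_ord exprVn.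
by [].
Qed.

(** Each sign takes its two values with total probability [1/2 + 1/2]; finitely many null sets are
    then discarded. *)
Lemma ae_sign_event : {ae P, forall w, exists s, sign_event s w}.
Proof.
have ae1 : {ae P, forall w, forall j, exists b : bool, D j w = (-1) ^+ b}.
  apply: filter_forall => j.
  pose B b := D j @^-1` [set (-1) ^+ nat_of_bool b : R].
  have mB b : measurable (B b) by exact: measurable_RV_preimage1.
  have mU : measurable (B true `|` B false) by exact: measurableU.
  exists (~` (B true `|` B false)); split; first exact: measurableC.
    have PU : P (B true `|` B false) = (P (B true) + P (B false))%E.
      rewrite measureU//; rewrite -subset0 => w []; rewrite /B/= => -> /eqP.
      by rewrite expr1 expr0 => /eqP e; have := @ltr01 R; rewrite -e; lra.
    have P1 : (P (B true) + P (B false) = 1)%E.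
      by rewrite /B !rademacher_sign -EFinD; congr (_%:E); lra.
    by apply: (etrans (probability_setC P mU)); rewrite PU P1 subee.
  by move=> w /= Dw [Bw|Bw]; apply: Dw; [exists true|exists false].
apply: filterS ae1 => w /choice[b bE].
by exists (finfun b); apply/sign_eventP => j; rewrite ffunE.
Qed.

End RandomSigns.

(** * Averaging the conditional error over the sign patterns *)

Theorem theorem3 (disp : measure_display) (T : measurableType disp)
    (R : realType) (P : probability T R)
    (m n k : nat) (hm : (1 <= m)%N) (hn : (1 <= n)%N) (hk : (2 < k)%N)
    (X : 'I_n -> 'cV[R]_(2 ^ m))
    (D : 'I_(2 ^ m) -> {RV P >-> R})
    (Y : 'I_n -> 'I_(2 ^ m) -> {RV P >-> R})
    (hD : iid_rademacher D)
    (hY : srk_protocol k (hadamard_rotation D) X Y) :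
  (srk_error (hadamard_rotation D) X Y <=
   ((2 * ln (2 ^ m)%:R + 2) / (n%:R * (k%:R - 1) ^+ 2) *
    (n%:R^-1 * \sum_(i < n) sqnorm (X i)))%:E)%E.
Proof.
have k1 : 0 < k%:R - 1 :> R by rewrite subr_gt0 ltr1n ltnW.
have n0 : 0 < n%:R :> R by rewrite ltr0n.
have d0 : 0 < (2 ^ m)%:R :> R by rewrite ltr0n expn_gt0.
pose q : R := 2 ^- (2 ^ m).
have q0 : 0 < q by rewrite invr_gt0 exprn_gt0.
have mA := measurable_sign_event D.
have /choice[h hP] (s : {ffun 'I_(2 ^ m) -> bool}) : exists h : T -> R,
    [/\ measurable_fun [set: T] h, forall w, 0 <= h w,
    {ae P, forall w, sign_event D s w ->
       sqnorm (srk_estimate (hadamard_rotation D) Y w - mean_vec X) = h w} &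
    (\int[P]_(w in sign_event D s) (h w)%:E <=
     (q * ((2 ^ m)%:R / (n%:R ^+ 2 * (4 * (k%:R - 1) ^+ 2)) *
       \sum_i (zmax (signed_hadamard s *m X i) -
               zmin (signed_hadamard s *m X i)) ^+ 2))%:E)%E].
  have PA := prob_sign_event hD s.
  have : (0 < P (hadamard_rotation D @^-1` [set signed_hadamard s]))%E.
    by rewrite sign_eventE PA lte_fin.
  move=> /hY; rewrite sign_eventE => HQ.
  have [h [mh h0 hE hint]] := quantization_error (ltnW hk) (mA s) PA q0 HQ.
  exists h; split=> //; apply: filterS hE => w hw Aw.
  rewrite -(hw Aw); have QQ := @signed_hadamard_orthogonal R m s.
  have QE : hadamard_rotation D w = signed_hadamard s.
    by move: Aw; rewrite -sign_eventE.
  have [_ uQ] := mulmx1_unit QQ.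
  rewrite /srk_estimate QE -[RHS](sqnorm_invmx_orthogonal _ QQ) mulmxBr.
  congr (sqnorm (_ - _)).
  rewrite /mean_vec -scalemxAr mulmx_sumr; congr (_ *: _).
  by apply: eq_bigr => i _; rewrite mulKmx.
(* A measurable majorant of the error: almost everywhere on [sign_event D s] the summand of [s]
   equals the error, and the other summands are nonnegative. This avoids measurability of the error
   itself, which involves [invmx]. *)
pose G w := (\sum_s ((fun w => (h s w)%:E) \_ (sign_event D s)) w)%E.
have mh s : measurable_fun [set: T] ((fun w => (h s w)%:E) \_ (sign_event D s)).
  apply/(measurable_restrictT _ (mA s)).1.
  apply: measurable_funTS; apply/measurable_EFinP.
  by have [] := hP s.
have h0 s w : (0 <= ((fun w => (h s w)%:E) \_ (sign_event D s)) w)%E.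
  by apply: erestrict_ge0 => x _; rewrite lee_fin; have [] := hP s.
have fG : (srk_error (hadamard_rotation D) X Y <= \int[P]_w G w)%E.
  rewrite /srk_error unlock; apply: ae_le_ge0_integral.
  - by move=> w; rewrite lee_fin sqnorm_ge0.
  - by move=> w; exact: sume_ge0.
  - exact: emeasurable_sum.
  have aeh : {ae P, forall w, forall s, sign_event D s w ->
      sqnorm (srk_estimate (hadamard_rotation D) Y w - mean_vec X) = h s w}.
    by apply: filter_forall => s; have [] := hP s.
  apply: filterS2 aeh (ae_sign_event hD) => w hw [s Aw].
  rewrite (hw s Aw) /G (bigD1 s)//= patchE mem_set// leeDl//.
  by apply: sume_ge0.
apply: (le_trans fG); rewrite ge0_integral_sum//.
pose C : R := (2 ^ m)%:R / (n%:R ^+ 2 * (4 * (k%:R - 1) ^+ 2)).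
pose rg s i := (zmax (signed_hadamard s *m X i) -
               zmin (signed_hadamard s *m X i)) ^+ 2.
apply: (@le_trans _ _ (\sum_(s : {ffun 'I_(2 ^ m) -> bool})
    (q * (C * \sum_i rg s i))%:E)).
  apply: lee_sum => s _; rewrite -integral_mkcond.
  by have [] := hP s.
rewrite sumEFin lee_fin -mulr_sumr -mulr_sumr exchange_big/=.
have C0 : 0 <= C.
  by rewrite divr_ge0// ltW// mulr_gt0 ?exprn_gt0// mulr_gt0// exprn_gt0.
apply: (@le_trans _ _ (q * (C * \sum_(i < n) (2 ^+ (2 ^ m) *
    (4 * (2 * ln (2 ^ m)%:R + 2) / (2 ^ m)%:R * sqnorm (X i)))))).
  rewrite ler_wpM2l ?(ltW q0)// ler_wpM2l// ler_sum// => i _.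
  exact: sum_signed_hadamard_range_le.
(* The probability [q] of a pattern cancels the number of patterns. What remains is an equality,
   since [4 / 2 ^ m] cancels the matching factor of [C]. *)
rewrite -mulr_sumr -mulr_sumr mulrCA /q mulKf ?gt_eqF ?exprn_gt0//.
rewrite le_eqVlt /C; apply/orP; left; apply/eqP; field.
by rewrite !gt_eqF.
Qed.
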